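(* Let $N\in\mathbb N$ and $n\in\{1,\dots,N-1\}$ be fixed. The zeros of the Hahn polynomial $H_n^{(\alpha,\beta)}$ ($\alpha>-1$, $\beta>-1$) are strictly decreasing functions of $\alpha$ on $(-1,\infty)$ (for fixed $\beta$) and strictly increasing functions of $\beta$ on $(-1,\infty)$ (for fixed $\alpha$).
   Context: For $\alpha>-1$, $\beta>-1$, the Hahn polynomial of degree $n$ in $X$ is $$H_n^{(\alpha,\beta)}(X)={}_3F_2\left(\left.{-n,\,-X,\,\alpha+\beta+n+1\atop \beta+1,\,1-N}\right|1\right)=\sum_{k=0}^n\frac{(-n)_k(-X)_k(\alpha+\beta+n+1)_k}{(\beta+1)_k(1-N)_k\,k!},$$ where $(u)_k=\prod_{j=1}^k(u+j-1)$. Its $n$ zeros are real and distinct and lie in $(0,N-1)$; the statement refers to each zero (the zeros being arranged in increasing order) as a function of the parameter. *)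

(* Defs.v *)
From mathcomp Require Import all_boot all_order all_algebra.
From mathcomp Require Import polyrcf reals.

Set Implicit Arguments.
Unset Strict Implicit.
Unset Printing Implicit Defensive.

Import Order.TTheory GRing.Theory Num.Theory.

Local Open Scope ring_scope.

(* Pochhammer symbol (u)_k. It is used both for scalars and for u = - 'X in
   {poly R}. *)
Definition rising (A : pzRingType) (u : A) (k : nat) : A :=
  \prod_(1 <= j < k.+1) (u + j%:R - 1).

(* N is cast to R before the subtraction in 1 - N, so there is no truncation;
   the factors (1 - N)_k do not vanish for k <= n <= N - 1. *)
Definition hahn (R : realType) (N n : nat) (a b : R) : {poly R} :=
  \sum_(0 <= k < n.+1)
    (rising (- n%:R) k * rising (a + b + n%:R + 1) k /
     (rising (b + 1) k * rising (1 - N%:R) k * k`!%:R)) *: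
      rising (- 'X : {poly R}) k.

(* rootsR lists the distinct real roots in increasing order, so this is the
   zero of rank i counted from 0. The default 0 is used only if the polynomial
   has at most i real roots, which does not happen for i < n < N and
   a, b > -1. *)
Definition hahn_zero (R : realType) (N n i : nat) (a b : R) : R :=
  nth 0 (rootsR (hahn N n a b)) i.

(* Main.v *)
(* The Hahn polynomials are orthogonal on {0, ..., N-1} for the weight
   w(x) = C(N-1, x) (b+1)_x (a+1)_{N-1-x}. Raising b, or lowering a, multiplies
   w by a strictly increasing function of x, so everything follows from a
   Markov-type comparison: if w2/w1 increases, each zero y_k for w2 exceeds the
   corresponding zero x_k for w1.

   The comparison is proved without differentiating the zeros. Let q have the
   zeros x_i (i < k) and y_j (j > k). The polynomial (X - x_k) q^2 is
   nonnegative at every x_i, hence by Gauss quadrature its w1-sum is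
   nonnegative; likewise the w2-sum of (X - y_k) q^2 is nonpositive. So q^2 w1
   has mean abscissa at least x_k and q^2 w2 has mean abscissa at most y_k,
   whereas Chebyshev's sum inequality says that multiplying by w2/w1 strictly
   increases the mean. Thus x_k < y_k. *)
Require Import Defs.
From mathcomp Require Import all_boot all_order all_algebra.
From mathcomp Require Import polyrcf reals ring lra zify.

Set Implicit Arguments.
Unset Strict Implicit.
Unset Printing Implicit Defensive.

Import Order.TTheory GRing.Theory Num.Theory.

Local Open Scope ring_scope.

(** * Interpolation and sign changes of real polynomials *)

Lemma interpolation (F : fieldType) (s : seq F) (h : F -> F) :
  uniq s ->
  exists2 g : {poly F}, (size g <= size s)%N & {in s, forall z, g.[z] = h z}.
Proof.
elim: s => [|a s IHs] /=; first by exists 0; rewrite ?size_poly0.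
move=> /andP[a_s /IHs[g sz_g gE]].
pose P := \prod_(z <- s) ('X - z%:P).
have Pa : P.[a] != 0 by rewrite -rootE root_prod_XsubC.
exists (g + ((h a - g.[a]) / P.[a]) *: P).
  rewrite (leq_trans (size_polyD _ _)) // geq_max (leqW sz_g).
  by rewrite (leq_trans (size_scale_leq _ _)) // size_prod_XsubC.
move=> z; rewrite inE !hornerE => /orP[/eqP->|zs].
  by rewrite divfK // subrKC.
have /rootP-> : root P z by rewrite root_prod_XsubC.
by rewrite mulr0 addr0 gE.
Qed.

Lemma no_root_sign (R : rcfType) (p : {poly R}) :
  (forall x, ~~ root p x) -> forall x y, 0 <= p.[x] * p.[y].
Proof.
move=> rp x y; wlog le_xy : x y / x <= y.
  by move=> th; case: (leP x y) => [|/ltW] /th //; rewrite mulrC.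
rewrite leNgt; apply/negP => /(poly_ivtoo le_xy)[z _].
exact/negP.
Qed.

(** The list [s] consists of the roots of odd multiplicity. Multiplicities are avoided by splitting
    off one factor ['X - a%:P] at a time, each of which toggles the membership of [a] in [s].
    Constant sign is expressed through products of two values, which leaves open which sign it
    is. *)
Lemma constant_sign_multiple (R : rcfType) (p : {poly R}) :
  p != 0 ->
  exists s : seq R, [/\ uniq s, all (root p) s &
    let f := p * \prod_(z <- s) ('X - z%:P) in
    forall x y, 0 <= f.[x] * f.[y]].
Proof.
have [m] := ubnP (size p); elim: m p => // m IHm p szp p0.
case: (boolP (has (root p) (rootsR p))) => [/hasP[a _ ra]|nr]; last first.
  exists [::]; split=> //= x y; rewrite big_nil mulr1; apply: no_root_sign => z.
  apply: contra nr => rz; apply/hasP; exists z => //.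
  by rewrite -(roots_on_rootsR p0) // inE /= rz.
have /factor_theorem[p' Ep] := ra.
have p'0 : p' != 0 by apply: contraNneq p0 => p'0; rewrite Ep p'0 mul0r.
have [] := IHm p' _ p'0.
  by move: szp; rewrite Ep size_Mmonic ?monicXsubC // size_XsubC addn2.
move=> s [us rs sgn].
have rs' : all (root p) s.
  by apply/allP => z /(allP rs) rz; rewrite Ep rootM rz.
case: (boolP (a \in s)) => as_.
  exists (rem a s); split; first exact: rem_uniq.
    by apply/allP => z /mem_rem; apply/allP.
  have <- : p' * \prod_(z <- s) ('X - z%:P) =
            p * \prod_(z <- rem a s) ('X - z%:P); last exact: sgn.
  by rewrite Ep (big_rem _ as_) /= mulrA.
exists (a :: s); split; rewrite /= ?as_ ?ra //.
move=> x y; rewrite big_cons.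
have -> : p * (('X - a%:P) * \prod_(j <- s) ('X - j%:P)) =
   ('X - a%:P) ^+ 2 * (p' * \prod_(z <- s) ('X - z%:P)) by rewrite Ep; ring.
have E z : ((('X - a%:P) ^+ 2 * (p' * \prod_(z <- s) ('X - z%:P))).[z]) =
  (z - a) ^+ 2 * (p' * \prod_(z <- s) ('X - z%:P)).[z].
  by rewrite hornerM horner_exp hornerXsubC.
by rewrite !E mulrACA mulr_ge0 ?sgn // mulr_ge0 ?sqr_ge0.
Qed.

(** * Orthogonality on the nodes 0, ..., N-1: real simple zeros and Gauss quadrature *)

Section DiscreteOrthogonality.
Variables (R : rcfType) (N : nat).
Implicit Types (w : nat -> R) (p q f : {poly R}).

Definition wsum w f : R := \sum_(j < N) f.[j%:R] * w j.

Definition orthogonal_below w n p :=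
  forall q, (size q <= n)%N -> wsum w (p * q) = 0.

Lemma wsumD w f g : wsum w (f + g) = wsum w f + wsum w g.
Proof.
by rewrite -big_split; apply: eq_bigr => j _; rewrite hornerD mulrDl.
Qed.

Lemma wsumZ w c f : wsum w (c *: f) = c * wsum w f.
Proof. by rewrite mulr_sumr; apply: eq_bigr => j _; rewrite hornerZ mulrA. Qed.

Lemma node_roots_eq0 f :
  (size f <= N)%N -> (forall j, (j < N)%N -> root f j%:R) -> f = 0.
Proof.
move=> szf rf; apply: (@roots_geq_poly_eq0 _ f [seq j%:R | j <- iota 0 N]).
- by apply/allP => _ /mapP[j + ->]; rewrite mem_iota => /rf.
- by rewrite map_inj_uniq ?iota_uniq // => i j /eqP; rewrite eqr_nat => /eqP.
- by rewrite size_map size_iota.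
Qed.

Lemma node_nonroot f :
  (size f <= N)%N -> f != 0 -> exists2 j, (j < N)%N & ~~ root f j%:R.
Proof.
move=> szf f0; case: (pickP (fun j : 'I_N => ~~ root f j%:R)) => [j rj|rf].
  by exists j.
case/negP: f0; apply/eqP/node_roots_eq0 => // j ltj.
by move/negbFE: (rf (Ordinal ltj)).
Qed.

(** Allows orthogonality to be tested on a basis adapted to the weight; for Hahn polynomials it will
    be the rising factorials of X + b + 1. *)
Lemma orthogonal_below_basis w n p (e : nat -> {poly R}) :
  (forall m, size (e m) = m.+1) ->
  (forall m, (m < n)%N -> wsum w (p * e m) = 0) -> orthogonal_below w n p.
Proof.
move=> sze; elim: n => [|n IHn] orth q szq.
  move: szq; rewrite leqn0 size_poly_eq0 => /eqP->.
  by rewrite mulr0 /wsum big1 // => j _; rewrite horner0 mul0r.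
have en0 : (e n)`_n != 0.
  by have := lead_coefE (e n); rewrite sze /= => <-;
    rewrite lead_coef_eq0 -size_poly_eq0 sze.
pose c := q`_n / (e n)`_n.
have szqc : (size (q - c *: e n)%R <= n)%N.
  apply/leq_sizeP => j; rewrite leq_eqVlt coefB coefZ => /orP[/eqP<-|ltnj].
    by rewrite divfK ?subrr.
  by rewrite !nth_default ?sze ?mulr0 ?subrr // (leq_trans szq).
rewrite -(subrK (c *: e n) q) mulrDr -scalerAr wsumD wsumZ orth // mulr0 addr0.
by apply: IHn => // m ltm; apply: orth; apply: ltnW.
Qed.

Variables (n : nat) (w : nat -> R) (p : {poly R}).
Hypotheses (ltnN : (n < N)%N) (w_gt0 : forall j, (j < N)%N -> 0 < w j).
Hypotheses (szp : size p = n.+1) (orth : orthogonal_below w n p).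

Let p_neq0 : p != 0. Proof. by rewrite -size_poly_eq0 szp. Qed.

(** If p had fewer than n roots of odd multiplicity, its product with the linear factors at these
    roots would have constant sign and weighted sum 0, hence vanish at all N nodes. So would p,
    whose degree n is less than N. *)
Lemma orthogonal_roots : size (rootsR p) = n.
Proof.
have szle : (size (rootsR p) <= n)%N.
  rewrite -ltnS -szp; apply: max_poly_roots => //; last exact: uniq_roots.
  by apply/allP => x; rewrite -(roots_on_rootsR p_neq0) => /andP[].
have [s [us rs sgn]] := constant_sign_multiple p_neq0.
apply/eqP; rewrite eqn_leq szle /=.
apply: (@leq_trans (size s)); last first.
  apply: uniq_leq_size => // x /(allP rs) rx.
  by rewrite -(roots_on_rootsR p_neq0) // inE /= rx.
rewrite leqNgt; apply/negP => lts.
set d := \prod_(z <- s) _ in sgn.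
have S0 : wsum w (p * d) = 0 by apply: orth; rewrite size_prod_XsubC.
have pd0 j : (j < N)%N -> (p * d).[j%:R] = 0.
  (* The sign of [p * d] is unknown, but multiplying the sum by the value at node j makes every term
     nonnegative; the term i = j then gives the claim. *)
  move=> ltj; have : \sum_(i < N) (p * d).[j%:R] * (p * d).[i%:R] * w i = 0.
    transitivity ((p * d).[j%:R] * wsum w (p * d)); last by rewrite S0 mulr0.
    by rewrite mulr_sumr; apply: eq_bigr => i _; rewrite mulrA.
  have ge0 (i : 'I_N) : true -> 0 <= (p * d).[j%:R] * (p * d).[i%:R] * w i.
    by move=> _; rewrite mulr_ge0 ?sgn // ltW ?w_gt0.
  move/eqP; rewrite (psumr_eq0 _ ge0) => /allP/(_ (Ordinal ltj)).
  rewrite mem_index_enum => /(_ isT) /=; rewrite mulf_eq0.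
  by rewrite (gt_eqF (w_gt0 ltj)) orbF mulf_eq0 orbb => /eqP.
suff p0 : p = 0 by move: p_neq0; rewrite p0 eqxx.
(* A node that is a root of [d] is also a root of [p], since [s] consists of roots of [p]. *)
apply: node_roots_eq0 => [|j /pd0/rootP]; first by rewrite szp.
rewrite rootM => /orP[//|]; rewrite root_prod_XsubC; exact/allP.
Qed.

(* Modulo p, f agrees with the square of the polynomial interpolating its
   square root at the zeros. *)
Lemma gauss_ge0 f :
  (size f <= n.*2)%N -> (forall z, root p z -> 0 <= f.[z]) -> 0 <= wsum w f.
Proof.
move=> szf f_ge0.
have mem_rR z : (z \in rootsR p) = root p z.
  by rewrite -(roots_on_rootsR p_neq0) // inE.
have [g szg gE] := interpolation (fun z => Num.sqrt f.[z])
                     (uniq_roots _ _ p : uniq (rootsR p)).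
rewrite orthogonal_roots in szg.
have [q qE] : exists q, f - g ^+ 2 = q * p.
  apply/Pdiv.Field.dvdpP.
  have pE := all_roots_prod_XsubC (p := p) (rs := rootsR p).
  rewrite pE ?uniq_rootsE ?orthogonal_roots ?uniq_roots //; last first.
    by apply/allP => z; rewrite mem_rR.
  rewrite dvdpZl ?lead_coef_eq0 //; apply: uniq_roots_dvdp.
    apply/allP => z zr; rewrite rootE !hornerE gE // sqr_sqrtr ?subrr //.
    by rewrite f_ge0 // -mem_rR.
  by rewrite uniq_rootsE uniq_roots.
have szq : (size q <= n)%N.
  have [->|q0] := eqVneq q 0; first by rewrite size_poly0.
  have := size_mul q0 p_neq0; rewrite -qE szp addnS /= => szqp.
  have : (size (f - g ^+ 2)%R <= n.*2)%N.
    rewrite (leq_trans (size_polyD _ _)) // geq_max szf size_polyN.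
    rewrite expr2 (leq_trans (size_polyMleq _ _)) // -addnn.
    by rewrite (leq_trans (leq_pred _)) ?leq_add.
  by rewrite szqp -addnn leq_add2r.
have -> : f = p * q + g ^+ 2 by rewrite mulrC -qE subrK.
rewrite wsumD orth // add0r; apply: sumr_ge0 => j _.
by rewrite horner_exp mulr_ge0 ?sqr_ge0 // ltW ?w_gt0.
Qed.

End DiscreteOrthogonality.

(** * Chebyshev's sum inequality and the comparison of zeros *)

(** Twice the difference of the two sides is the double sum of [D i j], whose two varying factors
    always have the same sign. Two nodes with nonzero [A] supply a strictly positive term. *)
Lemma chebyshev_sum_lt (R : realDomainType) (N : nat) (A w1 w2 : nat -> R) :
  (forall j, (j < N)%N -> 0 <= A j) ->
  (forall i j, (i < j)%N -> (j < N)%N -> w2 i * w1 j < w2 j * w1 i) ->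
  (exists a b, [/\ (a < b)%N, (b < N)%N, A a != 0 & A b != 0]) ->
  (\sum_(j < N) j%:R * A j * w1 j) * (\sum_(j < N) A j * w2 j) <
  (\sum_(j < N) j%:R * A j * w2 j) * (\sum_(j < N) A j * w1 j).
Proof.
move=> A_ge0 w12 [a [b [ltab ltb Aa Ab]]].
pose D (i j : 'I_N) :=
  A i * A j * ((i%:R - j%:R) * (w2 i * w1 j - w2 j * w1 i)).
have D_ge0 i j : 0 <= D i j.
  apply: mulr_ge0; first by rewrite mulr_ge0 ?A_ge0.
  case: (ltngtP i j) => [ltij|ltji|->].
  - by rewrite mulr_le0 // subr_le0 ?ler_nat 1?ltnW // ltW ?w12.
  - by rewrite mulr_ge0 // subr_ge0 ?ler_nat 1?ltnW // ltW ?w12.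
  - by rewrite subrr mul0r.
pose a' := Ordinal (ltn_trans ltab ltb); pose b' := Ordinal ltb.
have D_gt0 : 0 < D a' b'.
  apply: mulr_gt0.
    by rewrite mulr_gt0 // lt0r ?Aa ?Ab A_ge0 // (ltn_trans ltab).
  by rewrite nmulr_rgt0 subr_lt0 ?ltr_nat // w12.
have : 0 < \sum_i \sum_j D i j.
  rewrite (bigD1 a') //= (bigD1 b') //= -addrA ltr_wpDr //.
  by rewrite addr_ge0 ?sumr_ge0 // => i _; rewrite sumr_ge0.
set T1 := \sum_(j < N) j%:R * A j * w1 j; set S2 := \sum_(j < N) A j * w2 j.
set T2 := \sum_(j < N) j%:R * A j * w2 j; set S1 := \sum_(j < N) A j * w1 j.
have -> : \sum_i \sum_j D i j = (T2 * S1 - T1 * S2) + (S1 * T2 - S2 * T1).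
  rewrite !big_distrlr /= -!sumrB -big_split /=; apply: eq_bigr => i _.
  rewrite -!sumrB -big_split /=; apply: eq_bigr => j _.
  by rewrite /D; ring.
by rewrite [S1 * T2]mulrC [S2 * T1]mulrC -mulr2n pmulrn_lgt0 // subr_gt0.
Qed.

Lemma markov_zeros (R : rcfType) (N n : nat) (w1 w2 : nat -> R)
    (p1 p2 : {poly R}) :
  (n < N)%N ->
  (forall j, (j < N)%N -> 0 < w1 j) -> (forall j, (j < N)%N -> 0 < w2 j) ->
  (forall i j, (i < j)%N -> (j < N)%N -> w2 i * w1 j < w2 j * w1 i) ->
  size p1 = n.+1 -> orthogonal_below N w1 n p1 ->
  size p2 = n.+1 -> orthogonal_below N w2 n p2 ->
  forall k, (k < n)%N -> (rootsR p1)`_k < (rootsR p2)`_k.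
Proof.
move=> ltnN w1_gt0 w2_gt0 w12 szp1 orth1 szp2 orth2 k ltk.
rewrite ltNge; apply/negP => le_yx.
have szx := orthogonal_roots ltnN w1_gt0 szp1 orth1.
have szy := orthogonal_roots ltnN w2_gt0 szp2 orth2.
have p10 : p1 != 0 by rewrite -size_poly_eq0 szp1.
have p20 : p2 != 0 by rewrite -size_poly_eq0 szp2.
set xs := rootsR p1 in le_yx szx *; set ys := rootsR p2 in le_yx szy *.
have sx : sorted <%R xs := sorted_roots _ _ _.
have sy : sorted <%R ys := sorted_roots _ _ _.
(* Both zeros of rank k are left out, so [q] has degree n - 1 and [f c] has degree 2n - 1, within
   the range of the quadrature. Possible repetitions in [s] do no harm. *)
pose s := take k xs ++ drop k.+1 ys.
have szs : size s = n.-1.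
  by rewrite size_cat size_take size_drop szx szy ltk; lia.
pose q := \prod_(z <- s) ('X - z%:P).
have szq : size q = n by rewrite size_prod_XsubC szs; lia.
have q0 : q != 0 by rewrite -size_poly_eq0 szq; lia.
have rq z : z \in s -> q.[z] = 0.
  by move=> zs; apply/rootP; rewrite root_prod_XsubC.
pose f c : {poly R} := ('X - c%:P) * q ^+ 2.
have fE c z : (f c).[z] = (z - c) * q.[z] ^+ 2.
  by rewrite hornerM hornerXsubC horner_exp.
have szf c : (size (f c) <= n.*2)%N.
  rewrite (leq_trans (size_polyMleq _ _)) // size_XsubC.
  by rewrite (leq_ltn_trans (size_poly_exp_leq q 2)) // szq; lia.
have mem_xs z : root p1 z -> z \in xs.
  by rewrite -(roots_on_rootsR p10) // inE.
have mem_ys z : root p2 z -> z \in ys.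
  by rewrite -(roots_on_rootsR p20) // inE.
have ge1 : 0 <= wsum N w1 (f xs`_k).
  apply: (gauss_ge0 ltnN w1_gt0 szp1 orth1 (szf _)).
  move=> _ /mem_xs/(nthP 0)[i lti <-]; rewrite fE.
  case: (ltnP i k) => [ltik|leki].
    rewrite (rq xs`_i) ?expr0n ?mulr0 // mem_cat -(nth_take 0 ltik) mem_nth //.
    by rewrite size_take szx ltk.
  rewrite mulr_ge0 ?sqr_ge0 // subr_ge0.
  by rewrite (lt_sorted_leq_nth 0 sx) ?inE ?szx // -szx.
have ge2 : 0 <= wsum N w2 (- f ys`_k).
  apply: (gauss_ge0 ltnN w2_gt0 szp2 orth2); first by rewrite size_polyN szf.
  move=> _ /mem_ys/(nthP 0)[i lti <-]; rewrite hornerN fE.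
  case: (ltnP k i) => [ltki|leik].
    rewrite (rq ys`_i) ?expr0n ?mulr0 ?oppr0 // mem_cat.
    have -> : ys`_i = (drop k.+1 ys)`_(i - k.+1) by rewrite nth_drop subnKC.
    by rewrite mem_nth ?orbT // size_drop ltn_sub2r // (leq_ltn_trans ltki).
  rewrite -mulNr mulr_ge0 ?sqr_ge0 // opprB subr_ge0.
  by rewrite (lt_sorted_leq_nth 0 sy) ?inE ?szy // -szy.
pose A (j : nat) := q.[j%:R] ^+ 2.
pose S (w : nat -> R) := \sum_(j < N) A j * w j.
pose T (w : nat -> R) := \sum_(j < N) j%:R * A j * w j.
have wsumf w c : wsum N w (f c) = T w - c * S w.
  rewrite mulr_sumr -sumrB; apply: eq_bigr => j _.
  by rewrite fE mulrBl mulrBl !mulrA.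
(* Strictness needs two nodes where [q] does not vanish. The second comes from [q * ('X - a%:R%:P)],
   of degree n, which is still less than N. *)
have [a lta qa] : exists2 j, (j < N)%N & ~~ root q j%:R.
  by apply: node_nonroot => //; rewrite szq ltnW.
have [b ltb] : exists2 j, (j < N)%N & ~~ root (q * ('X - a%:R%:P)) j%:R.
  apply: node_nonroot; last by rewrite mulf_neq0 ?polyXsubC_eq0.
  by rewrite size_Mmonic ?monicXsubC // size_XsubC szq addn2.
rewrite rootM negb_or root_XsubC eqr_nat => /andP[qb neq_ba].
have Anz j : ~~ root q j%:R -> A j != 0 by rewrite sqrf_eq0 rootE.
have := @chebyshev_sum_lt R N A w1 w2 (fun j _ => sqr_ge0 _) w12.
rewrite -/(T w1) -/(T w2) -/(S w1) -/(S w2) ltNge => /(_ _)/negP[].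
  case: (ltngtP a b) neq_ba => // [ltab|ltba] _.
    by exists a, b; split => //; apply: Anz.
  by exists b, a; split => //; apply: Anz.
have S_ge0 (w : nat -> R) : (forall j, (j < N)%N -> 0 < w j) -> 0 <= S w.
  by move=> w0; apply: sumr_ge0 => j _; rewrite mulr_ge0 ?sqr_ge0 // ltW ?w0.
move: ge1 ge2; rewrite -scaleN1r wsumZ !wsumf.
have := S_ge0 _ w1_gt0; have := S_ge0 _ w2_gt0; move: le_yx.
move: xs`_k ys`_k (S w1) (S w2) (T w1) (T w2) => x y S1 S2 T1 T2.
move=> le_yx S20 S10 ge1 ge2.
(* The chain T2 S1 <= y S2 S1 <= x S1 S2 <= T1 S2 contradicts Chebyshev's inequality. *)
have le1 : x * S1 <= T1 by lra.
have le2 : T2 <= y * S2 by lra.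
apply: le_trans (ler_wpM2r S10 le2) _.
apply: le_trans (ler_wpM2r S20 le1).
by rewrite [X in _ <= X]mulrAC !ler_wpM2r.
Qed.

(** * Rising factorials, Vandermonde's identity and finite differences *)

Lemma rising0 (A : pzRingType) (u : A) : rising u 0 = 1.
Proof. by rewrite /rising big_geq. Qed.

Lemma risingS (A : pzRingType) (u : A) k :
  rising u k.+1 = rising u k * (u + k%:R).
Proof. by rewrite /rising big_nat_recr //= -addrA -natr1 addrK. Qed.

Lemma risingD (A : pzRingType) (u : A) j k :
  rising u (j + k) = rising u j * rising (u + j%:R) k.
Proof.
elim: k => [|k IHk]; first by rewrite addn0 rising0 mulr1.
by rewrite addnS !risingS IHk natrD !mulrA addrA.
Qed.

Lemma rising_gt0 (F : numDomainType) (u : F) k : 0 < u -> 0 < rising u k.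
Proof.
move=> u0; elim: k => [|k IHk]; first by rewrite rising0.
by rewrite risingS mulr_gt0 // ltr_wpDr.
Qed.

Lemma risingN_ffact (A : comPzRingType) m k :
  rising (- m%:R : A) k = (-1) ^+ k * (m ^_ k)%:R.
Proof.
elim: k => [|k IHk]; first by rewrite rising0 ffactn0 mulr1.
rewrite risingS IHk ffactnSr natrM exprS.
case: (leqP k m) => [lekm|ltmk]; last by rewrite ffact_small // !(mul0r, mulr0).
by rewrite natrB //; ring.
Qed.

(** Induction on K: the new factor a + b + K splits as (a + y) + (b + K - y), and Pascal's rule
    recombines the two sums. *)
Lemma rising_vandermonde (A : comPzRingType) (a b : A) K :
  \sum_(y < K.+1) 'C(K, y)%:R * rising a y * rising b (K - y) =
  rising (a + b) K.
Proof.
elim: K => [|K IHK]; first by rewrite big_ord1 bin0 subn0 !rising0 !mulr1.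
rewrite risingS -IHK mulr_suml.
transitivity (\sum_(y < K.+1) ('C(K, y)%:R * rising a y.+1 * rising b (K - y))
  + \sum_(y < K.+1) ('C(K, y)%:R * rising a y * rising b (K - y).+1));
  last first.
  rewrite -big_split; apply: eq_bigr => -[y /=]; rewrite ltnS => leyK _.
  by rewrite !risingS natrB //; ring.
rewrite big_ord_recl [X in _ = _ + X]big_ord_recl /= !bin0 !subn0.
rewrite [RHS]addrCA; congr (_ + _).
under eq_bigr => y _ do rewrite /bump /= add1n binS subSS natrD !mulrDl.
rewrite big_split /= addrC; congr (_ + _).
rewrite big_ord_recr /= bin_small // !mul0r addr0.
apply: eq_bigr => -[y /= lty] _; rewrite /bump /= add1n.
by congr (_ * _ * rising _ _); lia.
Qed.

(** An n-th finite difference kills degree below n. Writing f = X g + c, the constant contributes a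
    multiple of (1 - 1)^(n+1), and k C(n+1, k) = (n+1) C(n, k-1) reduces the rest to g(X + 1) at
    order n. *)
Lemma binomial_alternating_sum (F : idomainType) n (f : {poly F}) :
  (size f <= n)%N -> \sum_(k < n.+1) (-1) ^+ k * 'C(n, k)%:R * f.[k%:R] = 0.
Proof.
elim: n f => [|n IHn] f; first by rewrite leqn0 size_poly_eq0 => /eqP->;
  rewrite big1 // => i _; rewrite horner0 mulr0.
elim/poly_ind: f => [|g c _] szf.
  by rewrite big1 // => i _; rewrite horner0 mulr0.
have szg : (size g <= n)%N.
  move: szf; rewrite size_MXaddC; case: ifP => [/andP[/eqP-> _]|_] //.
  by rewrite size_poly0.
have C0 : \sum_(k < n.+2) (-1) ^+ k * 'C(n.+1, k)%:R = 0 :> F.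
  have := exprBn (1 : F) 1 n.+1; rewrite subrr expr0n => E.
  rewrite [RHS]E; apply: eq_bigr => i _.
  by rewrite !expr1n !mulr1 mulr_natr.
have gC : (size (g \Po ('X + 1%:P)) <= n)%N.
  by rewrite size_comp_poly2 // size_XaddC.
under eq_bigr => k _ do rewrite hornerMXaddC mulrDr.
rewrite big_split /= -mulr_suml C0 mul0r addr0.
rewrite big_ord_recl mulr0n !mulr0 add0r.
rewrite -[RHS](mulr0 (- n.+1%:R)) -[X in _ = _ * X](IHn _ gC) mulr_sumr.
apply: eq_bigr => -[k /= ltk] _; rewrite /bump /= add1n.
rewrite horner_comp !hornerE natr1 exprS.
have := congr1 (fun m => m%:R : F) (mul_bin_diag n.+1 k); rewrite /= !natrM.
move=> E; transitivity (- ((-1) ^+ k * g.[k.+1%:R]) * (n.+1%:R * 'C(n, k)%:R)).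
  by rewrite E; ring.
by ring.
Qed.

(** Both sides count the x-subsets of an M-set together with an ordered choice of k of their
    elements. *)
Lemma bin_ffact_shift M k x :
  (k <= x <= M)%N -> ('C(M, x) * x ^_ k = M ^_ k * 'C(M - k, x - k))%N.
Proof.
elim: k M x => [|k IHk] M x; first by rewrite !ffactn0 !subn0 muln1 mul1n.
case: x => [|x]; case: M => [|M] //; rewrite !ltnS => /IHk E.
rewrite !ffactnS /= !subSS mulnA [('C(_, _) * _)%N]mulnC.
by rewrite -(mul_bin_diag M.+1) -mulnA E mulnA.
Qed.

Lemma horner_rising (A : comNzRingType) (p : {poly A}) k x :
  (rising p k).[x] = rising p.[x] k.
Proof.
elim: k => [|k IHk]; first by rewrite !rising0 hornerC.
by rewrite !risingS hornerM IHk hornerD -polyC_natr hornerC.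
Qed.

Lemma size_rising (A : idomainType) (p : {poly A}) k :
  size p = 2%N -> size (rising p k) = k.+1.
Proof.
move=> szp; elim: k => [|k IHk]; first by rewrite rising0 size_poly1.
have szpk : size (p + k%:R) = 2%N.
  by rewrite size_polyDl // szp -polyC_natr (leq_ltn_trans (size_polyC_leq1 _)).
rewrite risingS size_mul ?IHk ?szpk ?addn2 //.
  by rewrite -size_poly_eq0 IHk.
by rewrite -size_poly_eq0 szpk.
Qed.

Lemma rising_lt (F : numDomainType) (u v : F) k :
  0 < u -> u < v -> (0 < k)%N -> rising u k < rising v k.
Proof.
move=> u0 uv; case: k => // k _.
elim: k => [|k IHk]; first by rewrite !risingS !rising0 !mul1r !addr0.
rewrite risingS [ltRHS]risingS ltr_pM ?ltrD2r ?ltW ?rising_gt0 //.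
by rewrite ltr_wpDr.
Qed.

(** After cancelling (u)_j (v)_j, what remains is (u+j)_{k-j} < (v+j)_{k-j}. *)
Lemma rising_ratio_lt (F : numDomainType) (u v : F) j k :
  0 < u -> u < v -> (j < k)%N ->
  rising u k * rising v j < rising u j * rising v k.
Proof.
move=> u0 uv ltjk; have v0 := lt_trans u0 uv.
rewrite -(subnKC (ltnW ltjk)) !risingD mulrAC mulrA.
rewrite ltr_pM2l ?mulr_gt0 ?rising_gt0 //.
by rewrite rising_lt ?ltrD2r ?ltr_wpDr ?subn_gt0.
Qed.

(** * The Hahn weight: positivity, degree and orthogonality *)

(* M stands for N - 1. *)
Definition hahn_weight (R : realType) (M : nat) (a b : R) (x : nat) : R :=
  'C(M, x)%:R * rising (b + 1) x * rising (a + 1) (M - x).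

Lemma hahn_weight_gt0 (R : realType) M (a b : R) x :
  -1 < a -> -1 < b -> (x < M.+1)%N -> 0 < hahn_weight M a b x.
Proof.
move=> a1 b1 ltx; rewrite !mulr_gt0 ?ltr0n ?bin_gt0 //.
  by apply: rising_gt0; lra.
by apply: rising_gt0; lra.
Qed.

Section HahnOrthogonality.
Variables (R : realType) (M n : nat) (a b : R).
Hypotheses (lenM : (n <= M)%N) (a1 : -1 < a) (b1 : -1 < b).

Let b_gt0 : 0 < b + 1. Proof. by rewrite -ltrBlDr sub0r. Qed.

Lemma size_hahn : (0 < n)%N -> size (hahn M.+1 n a b) = n.+1.
Proof.
move=> n0; have szr k : size (rising (- 'X : {poly R}) k) = k.+1.
  by rewrite size_rising // size_polyN size_polyX.
have E1N : 1 - M.+1%:R = - M%:R :> R by rewrite -natr1; ring.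
rewrite /hahn big_nat_recr //= addrC; set c := (X in X *: rising _ n + _).
have c0 : c != 0.
  rewrite /c E1N !risingN_ffact !(mulf_neq0, invr_neq0) ?signr_eq0 ?pnatr_eq0;
    rewrite -?lt0n ?ffact_gt0 ?fact_gt0 // gt_eqF // rising_gt0 //.
  (* Since a + b > -2 and n >= 1, the base a + b + n + 1 exceeds n - 1 >= 0. *)
  have : (1 : R) <= n%:R by rewrite ler1n.
  move: a1 b1; lra.
rewrite size_polyDl size_scale ?szr // ltnS (leq_trans (size_sum _ _ _)) //.
apply/bigmax_leqP_seq => k; rewrite mem_index_iota => /= ltk _.
by rewrite (leq_trans (size_scale_leq _ _)) // szr.
Qed.

(** The factor [x ^_ k] kills the terms x < k. With x = y + k it turns C(M, x) into a multiple of
    C(M-k, y), and the rising factorials in b merge into (b+1)_{k+m} (b+1+k+m)_y, so Vandermonde's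
    identity applies. *)
Lemma hahn_moment k m : (k <= M)%N ->
  \sum_(x < M.+1) (x ^_ k)%:R * rising (x%:R + (b + 1)) m * hahn_weight M a b x
  = (M ^_ k)%:R * rising (b + 1) (k + m) *
    rising (a + b + 2 + (k + m)%:R) (M - k).
Proof.
move=> lekM; rewrite -(big_mkord xpredT (fun x => (x ^_ k)%:R *
  rising (x%:R + (b + 1)) m * hahn_weight M a b x)).
rewrite (@big_cat_nat _ _ _ k) ?(leqW lekM) //= big1_seq ?add0r; last first.
  by move=> x; rewrite mem_index_iota /= => ltx; rewrite ffact_small ?mul0r.
rewrite -{1}[k]add0n big_addn subSn // big_mkord.
have -> : a + b + 2 + (k + m)%:R = (b + 1 + (k + m)%:R) + (a + 1) by ring.
rewrite -(rising_vandermonde (b + 1 + (k + m)%:R)) mulr_sumr.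
apply: eq_bigr => -[y /= lty] _.
have -> : (M - k - y)%N = (M - (y + k))%N by lia.
have E : 'C(M, y + k)%:R * ((y + k) ^_ k)%:R =
         (M ^_ k)%:R * 'C(M - k, y)%:R :> R.
  by rewrite -!natrM bin_ffact_shift ?addnK //; lia.
have E2 : rising (b + 1) (y + k) * rising ((y + k)%:R + (b + 1)) m =
          rising (b + 1) (k + m) * rising (b + 1 + (k + m)%:R) y.
  by rewrite -risingD [_ + (b + 1)]addrC -risingD; congr rising; lia.
rewrite /hahn_weight.
transitivity (('C(M, y + k)%:R * ((y + k) ^_ k)%:R) *
  (rising (b + 1) (y + k) * rising ((y + k)%:R + (b + 1)) m) *
  rising (a + 1) (M - (y + k))); first by ring.
by rewrite E E2; ring.
Qed.

(* Against (X + b + 1)_m the weight merely shifts, since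
   (b+1)_x (b+1+x)_m = (b+1)_{x+m}; Vandermonde then sums over x, and what
   remains is an n-th difference of a polynomial of degree n - 1. *)
Lemma hahn_orthogonal :
  orthogonal_below M.+1 (hahn_weight M a b) n (hahn M.+1 n a b).
Proof.
apply: (@orthogonal_below_basis _ _ _ _ _
          (fun m => rising ('X + (b + 1)%:P) m)) => [m|m ltm].
  by rewrite size_rising // size_XaddC.
pose s := a + b; pose u := s + m%:R + 2.
have u_gt0 : 0 < u by rewrite /u /s; move: a1 b1 (ler0n R m); lra.
(* After summation over the nodes, the k-th term of the series becomes [K] times (-1)^k C(n, k)
   f(k). Here f has degree m + (n-1-m) = n - 1, and [K] collects the factors free of k. *)
pose f : {poly R} :=
  rising ('X + (b + 1)%:P) m * rising ('X + u%:P) (n.-1 - m).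
have szf : (size f <= n)%N.
  rewrite (leq_trans (size_polyMleq _ _)) // !size_rising ?size_XaddC //; lia.
pose K := rising u M / rising u (n.-1 - m).
rewrite -[RHS](mulr0 K) -[X in _ = _ * X](binomial_alternating_sum szf).
rewrite mulr_sumr.
pose c k : R := rising (- n%:R) k * rising (a + b + n%:R + 1) k /
     (rising (b + 1) k * rising (1 - M.+1%:R) k * k`!%:R).
transitivity (\sum_(j < M.+1) \sum_(k < n.+1) c k *
  (rising (- j%:R) k * rising (j%:R + (b + 1)) m * hahn_weight M a b j)).
  apply: eq_bigr => j _; rewrite hornerM horner_rising hornerD hornerX hornerC.
  rewrite /hahn big_mkord horner_sum -mulrA mulr_suml; apply: eq_bigr => k _.
  by rewrite hornerZ horner_rising hornerN hornerX -/(c k) !mulrA.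
rewrite exchange_big /=; apply: eq_bigr => -[k /= ltk] _.
rewrite -mulr_sumr.
have lekM : (k <= M)%N by lia.
transitivity (c k * ((-1) ^+ k * ((M ^_ k)%:R * rising (b + 1) (k + m) *
    rising (a + b + 2 + (k + m)%:R) (M - k)))).
  congr (_ * _); rewrite -hahn_moment // mulr_sumr; apply: eq_bigr => j _.
  by rewrite risingN_ffact !mulrA.
have -> : a + b + 2 + (k + m)%:R = u + k%:R by rewrite /u /s natrD; ring.
have E1N : 1 - M.+1%:R = - M%:R :> R by rewrite -natr1; ring.
rewrite /c E1N !risingN_ffact risingD /K.
rewrite hornerM !horner_rising !hornerD !hornerX !hornerC.
have -> : a + b + n%:R + 1 = u + (n.-1 - m)%:R.
  rewrite /u /s natrB; last by lia.
  by rewrite -subn1 natrB; [ring | lia].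
(* Two splittings of (u)_{k+n-1-m}: this trades a rising factorial of length k for one of fixed
   length n-1-m, a polynomial in k. *)
have E : rising u (n.-1 - m) * rising (u + (n.-1 - m)%:R) k =
         rising u k * rising (u + k%:R) (n.-1 - m).
  by rewrite -!risingD addnC.
have E2 : rising u M = rising u k * rising (u + k%:R) (M - k).
  by rewrite -risingD subnKC.
have E3 : (n ^_ k)%:R = 'C(n, k)%:R * k`!%:R :> R by rewrite -bin_ffact natrM.
have nz1 : rising u (n.-1 - m) != 0 by rewrite gt_eqF ?rising_gt0.
have nz2 : rising (b + 1) k != 0 by rewrite gt_eqF ?rising_gt0.
have nz3 : k`!%:R != 0 :> R by rewrite pnatr_eq0 -lt0n fact_gt0.
have nz4 : (M ^_ k)%:R != 0 :> R by rewrite pnatr_eq0 -lt0n ffact_gt0.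
have nz5 : (-1) ^+ k != 0 :> R by rewrite signr_eq0.
rewrite E2 E3 [k%:R + (b + 1)]addrC [k%:R + u]addrC.
have -> : rising (u + (n.-1 - m)%:R) k =
    rising u k * rising (u + k%:R) (n.-1 - m) / rising u (n.-1 - m).
  by rewrite -E mulrC mulKf.
by field; rewrite nz1 nz2 nz3 nz4 nz5.
Qed.
End HahnOrthogonality.

(** * Monotone weight ratios and conclusion *)

Lemma hahn_weight_lt_b (R : realType) M (a b1 b2 : R) i j :
  -1 < a -> -1 < b1 -> b1 < b2 -> (i < j)%N -> (j < M.+1)%N ->
  hahn_weight M a b2 i * hahn_weight M a b1 j <
  hahn_weight M a b2 j * hahn_weight M a b1 i.
Proof.
move=> a_gt b1_gt ltb ltij ltj; rewrite /hahn_weight.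
set ci := 'C(M, i)%:R; set cj := 'C(M, j)%:R.
set ri := rising (a + 1) (M - i); set rj := rising (a + 1) (M - j).
have p_gt0 : 0 < ci * cj * ri * rj.
  rewrite !mulr_gt0 ?ltr0n ?bin_gt0 ?rising_gt0 //; [|lra..].
  exact: ltnW (leq_trans ltij ltj).
have : rising (b1 + 1) j * rising (b2 + 1) i <
       rising (b1 + 1) i * rising (b2 + 1) j.
  by apply: rising_ratio_lt => //; lra.
rewrite -(ltr_pM2l p_gt0); congr (_ < _); ring.
Qed.

(** The parameter a enters through (a+1)_{M-x}, whose length decreases with x. This reverses the
    order, so the smaller parameter [a1] takes the place of [b2]. *)
Lemma hahn_weight_lt_a (R : realType) M (a1 a2 b : R) i j :
  -1 < b -> -1 < a1 -> a1 < a2 -> (i < j)%N -> (j < M.+1)%N ->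
  hahn_weight M a1 b i * hahn_weight M a2 b j <
  hahn_weight M a1 b j * hahn_weight M a2 b i.
Proof.
move=> b_gt a1_gt lta ltij ltj; rewrite /hahn_weight.
set ci := 'C(M, i)%:R; set cj := 'C(M, j)%:R.
set ri := rising (b + 1) i; set rj := rising (b + 1) j.
have p_gt0 : 0 < ci * cj * ri * rj.
  rewrite !mulr_gt0 ?ltr0n ?bin_gt0 ?rising_gt0 //; [|lra..].
  exact: ltnW (leq_trans ltij ltj).
have : rising (a1 + 1) (M - i) * rising (a2 + 1) (M - j) <
       rising (a1 + 1) (M - j) * rising (a2 + 1) (M - i).
  by apply: rising_ratio_lt; [lra | lra | lia].
rewrite -(ltr_pM2l p_gt0); congr (_ < _); ring.
Qed.

Theorem proposition3p1 (R : realType) (N n : nat) (hn : (1 <= n <= N - 1)%N) :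
  forall i : nat, (i < n)%N ->
    (forall b : R, -1 < b ->
       forall a1 a2 : R, -1 < a1 -> a1 < a2 ->
         hahn_zero N n i a2 b < hahn_zero N n i a1 b) /\
    (forall a : R, -1 < a ->
       forall b1 b2 : R, -1 < b1 -> b1 < b2 ->
         hahn_zero N n i a b1 < hahn_zero N n i a b2).
Proof.
(* For N = 0 the truncated N - 1 is 0, which contradicts 1 <= n. *)
case: N hn => [|M]; first by case: n.
rewrite subSS subn0 => /andP[n_gt0 lenM] i lti.
split=> [b b_gt a1 a2 a1_gt lta | a a_gt b1 b2 b1_gt ltb].
- have a2_gt := lt_trans a1_gt lta.
  apply: (@markov_zeros R M.+1 n
    (hahn_weight M a2 b) (hahn_weight M a1 b)) => //.
  + by move=> j; apply: hahn_weight_gt0.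
  + by move=> j; apply: hahn_weight_gt0.
  + by move=> k j; apply: hahn_weight_lt_a.
  + exact: size_hahn.
  + exact: hahn_orthogonal.
  + exact: size_hahn.
  + exact: hahn_orthogonal.
- have b2_gt := lt_trans b1_gt ltb.
  apply: (@markov_zeros R M.+1 n
    (hahn_weight M a b1) (hahn_weight M a b2)) => //.
  + by move=> j; apply: hahn_weight_gt0.
  + by move=> j; apply: hahn_weight_gt0.
  + by move=> k j; apply: hahn_weight_lt_b.
  + exact: size_hahn.
  + exact: hahn_orthogonal.
  + exact: size_hahn.
  + exact: hahn_orthogonal.
Qed.
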